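(* Let $m\ge2$ and $n\ge1$ be integers and let $\mathcal{C}$ be a symmetric Cauchy tensor of order $m$ and dimension $n$ with generating vector $c=(c_1,\dots,c_n)\in\mathbb{R}^n$. Suppose $\mathcal{C}$ is centrosymmetric. Then for any H-eigenvector $x\in\mathbb{R}^n$ of $\mathcal{C}$ corresponding to a nonzero H-eigenvalue: $x$ is symmetric when $m$ is even, and $|x|$ is symmetric when $m$ is odd.
   Context: Write $[n]=\{1,\dots,n\}$. Given $c=(c_1,\dots,c_n)\in\mathbb{R}^n$ with $c_{i_1}+\cdots+c_{i_m}\ne0$ for all $i_1,\dots,i_m\in[n]$, the (symmetric) Cauchy tensor of order $m$ and dimension $n$ with generating vector $c$ is the real tensor $\mathcal{C}=(c_{i_1\cdots i_m})$ with entries $c_{i_1i_2\cdots i_m}=\dfrac{1}{c_{i_1}+c_{i_2}+\cdots+c_{i_m}}$. A tensor $(a_{i_1\cdots i_m})$ of order $m$ and dimension $n$ is centrosymmetric if $a_{i_1\cdots i_m}=a_{n-i_1+1,\dots,n-i_m+1}$ for all indices in $[n]$. For $x\in\mathbb{R}^n$, $\mathcal{C}x^{m-1}\in\mathbb{R}^n$ has $i$-th component $\sum_{i_2,\dots,i_m=1}^n c_{ii_2\cdots i_m}x_{i_2}\cdots x_{i_m}$, and $x^{[m-1]}=(x_1^{m-1},\dots,x_n^{m-1})$. If $\lambda\in\mathbb{R}$ and $x\in\mathbb{R}^n\setminus\{0\}$ satisfy $\mathcal{C}x^{m-1}=\lambda x^{[m-1]}$, then $\lambda$ is an H-eigenvalue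 of $\mathcal{C}$ and $x$ an H-eigenvector corresponding to $\lambda$. A vector $x\in\mathbb{R}^n$ is symmetric if $x_{n-i+1}=x_i$ for all $i\in[n]$; $|x|=(|x_1|,\dots,|x_n|)$. *)

(* Defs.v *)
From mathcomp Require Import all_boot all_order all_algebra.
From mathcomp Require Import reals.

Set Implicit Arguments.
Unset Strict Implicit.
Unset Printing Implicit Defensive.

Import Order.TTheory GRing.Theory Num.Theory.
Local Open Scope ring_scope.

(* Indices are 0-based: {1, ..., n} is encoded by 'I_n, so that the reflection
   i |-> n - i + 1 becomes [rev_ord], i |-> n - 1 - i. *)

Definition tensor (R : Type) (m n : nat) : Type := {ffun m.-tuple 'I_n -> R}.

(* Inverses are total, with 0^-1 = 0: this is the Cauchy tensor generated by c
   only under [cauchy_generating m c]. *)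
Definition cauchy_generating (R : realType) (m n : nat) (c : 'rV[R]_n) : Prop :=
  forall t : m.-tuple 'I_n, \sum_(i <- t) c 0 i != 0.

Definition cauchy_tensor (R : realType) (m n : nat) (c : 'rV[R]_n) :
    tensor R m n :=
  [ffun t : m.-tuple 'I_n => (\sum_(i <- t) c 0 i)^-1].

Definition centrosymmetric (R : Type) (m n : nat) (A : tensor R m n) : Prop :=
  forall t : m.-tuple 'I_n, A t = A (map_tuple (@rev_ord n) t).

(* A x^(m-1): the i-th component sums over the multi-indices
   t = (i_1, ..., i_m) with i_1 = i. *)
Definition tensor_apply (R : realType) (m n : nat) (A : tensor R m n)
    (x : 'rV[R]_n) : 'rV[R]_n :=
  \row_(i < n) \sum_(t : m.-tuple 'I_n | ohead t == Some i)
    A t * \prod_(j <- behead t) x 0 j.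

Definition row_pow (R : realType) (n : nat) (x : 'rV[R]_n) (k : nat) :
    'rV[R]_n :=
  \row_(i < n) x 0 i ^+ k.

Definition H_eigenvector (R : realType) (m n : nat) (A : tensor R m n)
    (lambda : R) (x : 'rV[R]_n) : Prop :=
  x != 0 /\ tensor_apply A x = lambda *: row_pow x m.-1.

Definition symmetric_row (R : realType) (n : nat) (x : 'rV[R]_n) : Prop :=
  forall i : 'I_n, x 0 (rev_ord i) = x 0 i.

Definition row_abs (R : realType) (n : nat) (x : 'rV[R]_n) : 'rV[R]_n :=
  \row_(i < n) `|x 0 i|.

(* Main.v *)
(* The diagonal entries 1 / (m c_i) are reversal-invariant, hence so is c. The
   i-th component of C x^(m-1) depends on i only through c_i, so the eigenvalue
   equation makes the powers x_i^(m-1) reversal-invariant as well. *)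
Require Import Defs.
From mathcomp Require Import all_boot all_order all_algebra.
From mathcomp Require Import reals.

Import Order.TTheory GRing.Theory Num.Theory.
Local Open Scope ring_scope.

(** Prepending [i] and dropping the head are mutually inverse between [k]-tuples and [k.+1]-tuples
    with head [i]. *)
Lemma sum_tuple_ohead (V : nmodType) (T : finType) (k : nat) (i : T)
    (F : k.+1.-tuple T -> V) :
  \sum_(t : k.+1.-tuple T | ohead t == Some i) F t =
  \sum_(s : k.-tuple T) F (cons_tuple i s).
Proof.
rewrite (reindex_onto (cons_tuple i) (fun t => behead_tuple t)) /=; last first.
  by move=> t; case/tupleP: t => j s /= /eqP[->]; apply: val_inj.
apply: eq_bigl => s; rewrite eqxx /=.
by apply/eqP/val_inj.
Qed.

Lemma norm_exprn_inj (R : realDomainType) (k : nat) (x y : R) :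
  (0 < k)%N -> x ^+ k = y ^+ k -> `|x| = `|y|.
Proof.
move=> k_gt0 /(congr1 Num.norm); rewrite !normrX => /eqP.
by rewrite eqrXn2 // => /eqP.
Qed.

(** Equal powers force [x = y] or [x = - y]; in the second case oddness gives [y ^+ k = - y ^+ k],
    so both vanish. *)
Lemma exprn_odd_inj (R : realDomainType) (k : nat) (x y : R) :
  odd k -> x ^+ k = y ^+ k -> x = y.
Proof.
move=> k_odd xy; have k_gt0 : (0 < k)%N by case: k k_odd {xy}.
have /eqP := norm_exprn_inj _ _ _ _ k_gt0 xy.
rewrite eqr_norm2 => /orP[/eqP //|/eqP xNy].
have /eqP : y ^+ k = - y ^+ k by rewrite -{1}xy xNy exprNn -signr_odd k_odd mulN1r.
by rewrite -addr_eq0 -mulr2n mulrn_eq0 /= expf_eq0 k_gt0 xNy => /eqP ->; rewrite oppr0.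
Qed.

Lemma centrosymmetric_cauchy_generator (R : realType) (m n : nat)
    (c : 'rV[R]_n) :
  (0 < m)%N -> centrosymmetric (cauchy_tensor m c) -> symmetric_row c.
Proof.
move=> m_gt0 cs i; have := cs (nseq_tuple m i).
(* The total inverse is injective, also at [0] since [0^-1 = 0], so [m] times [c 0 i] is
   reversal-invariant. *)
rewrite !ffunE => /invr_inj; rewrite /= map_nseq !big_nseq !iter_addr_0.
by move=> /eqP; rewrite -subr_eq0 -mulrnBl mulrn_eq0 subr_eq0 eqn0Ngt m_gt0 => /eqP.
Qed.

Lemma cauchy_tensor_applyE (R : realType) (k n : nat) (c x : 'rV[R]_n)
    (i : 'I_n) :
  tensor_apply (cauchy_tensor k.+1 c) x 0 i =
  \sum_(s : k.-tuple 'I_n)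
    (c 0 i + \sum_(j <- s) c 0 j)^-1 * \prod_(j <- s) x 0 j.
Proof.
rewrite mxE sum_tuple_ohead; apply: eq_bigr => s _.
by rewrite ffunE big_cons.
Qed.

Theorem theorem5p4 (R : realType) (m n : nat) (hm : (2 <= m)%N)
    (hn : (1 <= n)%N) (c : 'rV[R]_n) (hc : cauchy_generating m c)
    (hcs : centrosymmetric (cauchy_tensor m c))
    (lambda : R) (hl : lambda != 0) (x : 'rV[R]_n)
    (hx : H_eigenvector (cauchy_tensor m c) lambda x) :
  (~~ odd m -> symmetric_row x) /\ (odd m -> symmetric_row (row_abs x)).
Proof.
have c_sym := centrosymmetric_cauchy_generator _ _ _ _ (ltnW hm) hcs.
(* With [m = k.+1], the bound [2 <= m] is [0 < k] by conversion, and the exponent [m.-1] is [k]. *)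
case: m hm hc hcs hx => // k k_gt0 _ _ [_ eig].
have pow_sym i : x 0 (rev_ord i) ^+ k = x 0 i ^+ k.
  apply: (mulfI hl).
  have eigE j : lambda * x 0 j ^+ k = tensor_apply (cauchy_tensor k.+1 c) x 0 j.
    by rewrite eig !mxE.
  by rewrite !eigE !cauchy_tensor_applyE c_sym.
(* The exponent [k] has parity opposite to [m]: for [m] even it is odd and the power map is
   injective; for [m] odd equality of powers still gives equality of absolute values. *)
split=> /= k_par i; first by apply: exprn_odd_inj (pow_sym i); rewrite -[odd k]negbK.
by rewrite !mxE; apply: norm_exprn_inj (pow_sym i).
Qed.
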